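(* Let $\mathfrak g$ be a real Lie algebra of dimension $2n$ and let $(\omega(t),g(t))$ be the $(p,q)$-flow solution on $\mathfrak g$ starting at an almost-hermitian structure $(\omega_0,g_0)$ on $\mathfrak g$, with associated $J_0$. Consider $c(t)>0$ and $\varphi(t)\in\mathrm{Aut}(\mathfrak g)$, both differentiable on $t$, with $c(0)=1$, $\varphi(0)=I$ and $D:=\varphi'(0)\in\mathrm{Der}(\mathfrak g)$. Then the following conditions are equivalent. (i) The solution has the form $$\omega(t)=c(t)\,\omega_0(\varphi(t)\cdot,\varphi(t)\cdot),\qquad g(t)=c(t)\,g_0(\varphi(t)\cdot,\varphi(t)\cdot).$$ (ii) The starting curvature tensors satisfy $$c'(0)I+(D-J_0D^tJ_0)=-2P(\omega_0,g_0),\qquad c'(0)I+(D+D^t)=-2Q(\omega_0,g_0).$$ (iii) The solution is precisely given by $$\omega(t)=(c'(0)t+1)\,\omega_0(e^{s(t)D}\cdot,e^{s(t)D}\cdot),\qquad g(t)=(c'(0)t+1)\,g_0(e^{s(t)D}\cdot,e^{s(t)D}\cdot),$$ where $s(t):=\frac{\log(c'(0)t+1)}{c'(0)}$ if $c'(0)\ne0$ and $s(t)=t$ when $c'(0)=0$.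
   Context: Almost-hermitian structures. On a real vector space $\mathfrak g$ of dimension $2n$, an almost-hermitian structure is a pair $(\omega,g)$, with $\omega$ a non-degenerate $2$-form and $g$ an inner product, such that the operator $J$ defined by $\omega=g(J\cdot,\cdot)$ satisfies $J^2=-I$ ($J_0$ is the operator associated to $(\omega_0,g_0)$). For $A\in\mathrm{End}(\mathfrak g)$, $A^{c}:=\frac12(A-JAJ)$. Here $D^t$ is the transpose of $D$ relative to $g_0$; $\mathrm{Der}(\mathfrak g)$ and $\mathrm{Aut}(\mathfrak g)$ are the derivations and automorphisms of the Lie algebra $\mathfrak g$. The pair $(p,q)$. One fixes a rule assigning to every almost-hermitian structure $(\omega,g)$ (a left-invariant structure on a Lie group being identified with its value on the Lie algebra) a $2$-form $p=p(\omega,g)\in\Lambda^2\mathfrak g^*$ and a symmetric bilinear form $q=q(\omega,g)\in S^2\mathfrak g^*$. Operators $P=P(\omega,g)$, $Q=Q(\omega,g)\in\mathrm{End}(\mathfrak g)$ are defined by $p=\omega(P\cdot,\cdot)$, $q=g(Q\cdot,\cdot)$. Standing assumptions: (a) diffeomorphism invariance, so that if $\varphi$ is a Lie algebra isomorphism with $\omega_1=\omega_2(\varphi\cdot,\varphi\cdot)$ and $g_1=g_2(\varphi\cdot,\varphi\cdot)$, then $P(\omega_2,g_2)=\varphi P(\omega_1,g_1)\varphi^{-1}$ and $Q(\omega_2,g_2)=\varphi Q(\omega_1,g_1)\varphi^{-1}$; (b) compatibility: $P^c=Q^c$ for every almost-hermitian structure; (c) scaling: $p(c\omega,cg)=p(\omega,g)$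 and $q(c\omega,cg)=q(\omega,g)$, equivalently $P(c\omega,cg)=\frac1cP(\omega,g)$ and $Q(c\omega,cg)=\frac1cQ(\omega,g)$, for all $c>0$. The $(p,q)$-flow on $\mathfrak g$ is the ODE system $\frac{d}{dt}\omega=-2p(\omega,g)$, $\frac{d}{dt}g=-2q(\omega,g)$ for a one-parameter family of almost-hermitian structures on $\mathfrak g$; short-time existence (forward and backward) and uniqueness of solutions hold.
   Formalization: Condition (i) is read as: the solution has this form for some admissible pair with the same c'(0) and D, since for the given pair (ii),(iii) do not imply (i) (p=q=0, c=1+t², φ=I); times are restricted to an interval on which c'(0)t+1>0, where s(t) makes sense. *)

(* Defs.v *)
From HB Require Import structures.
From mathcomp Require Import all_boot all_order all_algebra sesquilinear.
From mathcomp Require Import all_classical all_reals all_analysis.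
Set Implicit Arguments.
Unset Strict Implicit.
Unset Printing Implicit Defensive.
Import Order.TTheory GRing.Theory Num.Theory numFieldNormedType.Exports.
Local Open Scope classical_set_scope.
Local Open Scope ring_scope.

HB.mixin Record Vector_isLieAlgebra (R : nzRingType) (L : Type)
    of Vector R L := {
  lie : L -> L -> L;
  lie_bilinear : bilinear_for *:%R *:%R lie;
  lie_alternating : forall x : L, lie x x = 0;
  lie_jacobi : forall x y z : L,
    lie x (lie y z) + lie y (lie z x) + lie z (lie x y) = 0
}.

#[short(type="lieAlgType")]
HB.structure Definition LieAlgebra (R : nzRingType) :=
  { L of Vector_isLieAlgebra R L & Vector R L }.

Definition lie_iso (R : nzRingType) (L1 L2 : lieAlgType R)
    (phi : 'Hom(L1, L2)) : Prop :=
  bijective phi /\ forall x y : L1, phi (lie x y) = lie (phi x) (phi y).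

Definition lie_aut (R : nzRingType) (L : lieAlgType R) (phi : 'End(L)) : Prop :=
  lie_iso phi.

Definition derivation (R : nzRingType) (L : lieAlgType R) (D : 'End(L)) : Prop :=
  forall x y : L, D (lie x y) = lie (D x) y + lie x (D y).

(* A [vectType] carries no topology: limits and derivatives in it are taken
   coordinatewise in the canonical basis.  By finite-dimensionality the choice
   of basis is immaterial.  They are used below in the vector space 'End(L). *)
Section VectorCalculus.
Context {R : realType} {V : vectType R}.

Definition vcoord (i : 'I_(\dim {:V})) : V -> R := coord (vbasis {:V}) i.

Definition vlim (u : nat -> V) : V :=
  \sum_(i < \dim {:V}) limn (vcoord i \o u) *: (vbasis {:V})`_i.

Definition vderivable (f : R -> V) (t : R) : Prop :=
  forall i, derivable (vcoord i \o f) t 1.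

Definition vderive (f : R -> V) (t : R) : V :=
  \sum_(i < \dim {:V}) derive1 (vcoord i \o f) t *: (vbasis {:V})`_i.

End VectorCalculus.

Definition lfun_exp (R : realType) (V : vectType R) (A : 'End(V)) : 'End(V) :=
  vlim (fun N => \sum_(k < N) (k`!%:R)^-1 *: iter k (comp_lfun A) \1%VF).

(* The operator A such that a = b(A _, _).  It exists and is unique when b is a
   nondegenerate and a an arbitrary bilinear form, which is how it is used. *)
Definition form_op (R : realType) (V : vectType R) (b a : V -> V -> R) :
    'End(V) :=
  xget 0 [set A : 'End(V) | forall x y, a x y = b (A x) y].

Record almost_hermitian (R : realType) (V : vectType R) := AlmostHermitian {
  omega : {biscalar V};
  metric : {biscalar V};
  omega_alternating : forall x, omega x x = 0;
  omega_nondegenerate : forall x, (forall y, omega x y = 0) -> x = 0;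
  metric_symmetric : forall x y, metric x y = metric y x;
  metric_posdef : forall x, x != 0 -> 0 < metric x x;
  complex_structure_square :
    (form_op metric omega \o form_op metric omega)%VF = - \1%VF
}.

Section Operators.
Context {R : realType} {V : vectType R}.
Implicit Types (h : almost_hermitian V) (A : 'End(V)).

Definition Jop h : 'End(V) := form_op (metric h) (omega h).

Definition transpose h A : 'End(V) :=
  form_op (metric h) (fun x y => metric h x (A y)).

Definition cpart h A : 'End(V) := 2^-1 *: (A - (Jop h \o A \o Jop h)%VF).

Definition same_structure h1 h2 : Prop := forall x y,
  omega h1 x y = omega h2 x y /\ metric h1 x y = metric h2 x y.

End Operators.

Record curvature_rule (R : realType) := CurvatureRule {
  pform : forall L : lieAlgType R, almost_hermitian L -> {biscalar L};
  qform : forall L : lieAlgType R, almost_hermitian L -> {biscalar L};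
  pform_alternating : forall (L : lieAlgType R) (h : almost_hermitian L) (x : L),
    pform h x x = 0;
  qform_symmetric : forall (L : lieAlgType R) (h : almost_hermitian L) (x y : L),
    qform h x y = qform h y x
}.

Section Flow.
Context {R : realType}.
Implicit Types (K : curvature_rule R) (L : lieAlgType R).

Definition Pop K L (h : almost_hermitian L) : 'End(L) :=
  form_op (omega h) (pform K h).

Definition Qop K L (h : almost_hermitian L) : 'End(L) :=
  form_op (metric h) (qform K h).

Definition diffeo_invariant K : Prop :=
  forall (L1 L2 : lieAlgType R) (h1 : almost_hermitian L1)
    (h2 : almost_hermitian L2) (phi : 'Hom(L1, L2)),
  lie_iso phi ->
  (forall x y, omega h1 x y = omega h2 (phi x) (phi y)) ->
  (forall x y, metric h1 x y = metric h2 (phi x) (phi y)) ->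
  Pop K h2 = (phi \o Pop K h1 \o phi^-1)%VF /\
  Qop K h2 = (phi \o Qop K h1 \o phi^-1)%VF.

Definition compatible K : Prop :=
  forall L (h : almost_hermitian L), cpart h (Pop K h) = cpart h (Qop K h).

Definition scale_invariant K : Prop :=
  forall L (h1 h2 : almost_hermitian L) (c : R), 0 < c ->
  (forall x y, omega h2 x y = c * omega h1 x y) ->
  (forall x y, metric h2 x y = c * metric h1 x y) ->
  forall x y, pform K h2 x y = pform K h1 x y /\
              qform K h2 x y = qform K h1 x y.

Definition flow_solution K L (I : set R) (h : R -> almost_hermitian L) : Prop :=
  forall t, I t -> forall x y : L,
    is_derive t 1 (fun u => omega (h u) x y) (- 2 * pform K (h t) x y) /\
    is_derive t 1 (fun u => metric (h u) x y) (- 2 * qform K (h t) x y).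

Definition open_interval0 (I : set R) : Prop :=
  [/\ open I, is_interval I & I 0].

Definition short_time_existence K : Prop :=
  forall L (h0 : almost_hermitian L),
  exists I (h : R -> almost_hermitian L),
    [/\ open_interval0 I, h 0 = h0 & flow_solution K I h].

Definition flow_uniqueness K : Prop :=
  forall L (I : set R) (h1 h2 : R -> almost_hermitian L),
  open_interval0 I -> flow_solution K I h1 -> flow_solution K I h2 ->
  same_structure (h1 0) (h2 0) ->
  forall t, I t -> same_structure (h1 t) (h2 t).

(* The curvature equations at time 0 only see the first-order data
   (c'(0), phi'(0)): in an equivalence with them, "the solution has the form (c, phi)" is therefore to
   be read as "for some such pair with the prescribed c'(0) and phi'(0)". *)
Definition scaling_gauge L (I : set R) (c : R -> R) (phi : R -> 'End(L)) : Prop :=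
  [/\ forall t, I t -> 0 < c t /\ derivable c t 1,
      forall t, I t -> lie_aut (phi t) /\ vderivable phi t,
      c 0 = 1 & phi 0 = \1%VF].

Definition evolves_as L (I : set R) (h : R -> almost_hermitian L)
    (h0 : almost_hermitian L) (c : R -> R) (phi : R -> 'End(L)) : Prop :=
  forall t, I t -> forall x y : L,
    omega (h t) x y = c t * omega h0 (phi t x) (phi t y) /\
    metric (h t) x y = c t * metric h0 (phi t x) (phi t y).

Definition time_change (a t : R) : R :=
  if a == 0 then t else ln (a * t + 1) / a.

End Flow.

(* Main.v *)
From HB Require Import structures.
Require Import Defs.
From mathcomp Require Import all_boot all_order all_algebra sesquilinear.
From mathcomp Require Import all_classical all_reals all_analysis.
Import Order.TTheory GRing.Theory Num.Theory numFieldNormedType.Exports.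
Local Open Scope classical_set_scope.
Local Open Scope ring_scope.

(* Differentiating the ansatz [c(t) phi(t)^* h0] at 0 gives
   [a omega0(x, y) + omega0(D x, y) + omega0(x, D y)] with [a = c'(0)], which is
   [omega0((a + D - J0 D^t J0) x, y)], and similarly for the metric; comparing
   with the flow equations gives (ii).  Conversely, [E = exp(s(t) D)] is an
   automorphism, so naturality and scale invariance of (p, q) turn the equations
   (ii) at [(E x, E y)] into the flow equations for [(a t + 1) E^* h0] at time
   [t], and uniqueness gives (iii). *)

(** * Linear functionals and coordinatewise calculus *)

Lemma scalar0 (R : nzRingType) (V : lmodType R) (l : V -> R) :
  scalar l -> l 0 = 0.
Proof.
by move=> ll; have := ll (-1) 0 0; rewrite scaleN1r oppr0 addr0 mulN1r addNr.
Qed.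

Lemma scalar_comb (R : nzRingType) (V : lmodType R) (l : V -> R) (n : nat)
    (k : 'I_n -> R) (v : 'I_n -> V) :
  scalar l -> l (\sum_(i < n) k i *: v i) = \sum_(i < n) k i * l (v i).
Proof.
by move=> ll; elim/big_rec2: _ => [|i y x _ <-]; [exact: scalar0|rewrite ll].
Qed.

Section Coordinates.
Context {R : realType} {V : vectType R}.
Implicit Types (f : R -> V) (u : nat -> V) (l : V -> R).

Lemma vcoord_expand (v : V) :
  v = \sum_(i < \dim {:V}) vcoord i v *: (vbasis {:V})`_i.
Proof. exact: coord_vbasis (memvf v). Qed.

Lemma vcoord_scalar i : scalar (vcoord (V := V) i).
Proof. by move=> a x y; rewrite /vcoord linearP. Qed.

Lemma vcoord_sum (k : 'I_(\dim {:V}) -> R) i :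
  vcoord i (\sum_(j < \dim {:V}) k j *: (vbasis {:V})`_j) = k i.
Proof. exact: coord_sum_free (basis_free (vbasisP _)). Qed.

Lemma vcoordP (v w : V) : (forall i, vcoord i v = vcoord i w) -> v = w.
Proof.
move=> vw; rewrite (vcoord_expand v) (vcoord_expand w).
by apply: eq_bigr => i _; rewrite vw.
Qed.

Lemma scalar_vcoord l (v : V) : scalar l ->
  l v = \sum_(i < \dim {:V}) vcoord i v * l (vbasis {:V})`_i.
Proof. by move=> ll; rewrite {1}(vcoord_expand v) scalar_comb. Qed.

(** A functional is a finite combination of coordinates, so it commutes with the coordinatewise
    limit once every coordinate converges. *)
Lemma scalar_vlim l u : scalar l -> (forall i, cvgn (vcoord i \o u)) ->
  l (vlim u) = limn (l \o u).
Proof.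
move=> ll cu; rewrite /vlim scalar_comb//; apply/esym/cvg_lim => //.
have -> : l \o u = fun n =>
    \sum_(i < \dim {:V}) (vcoord i \o u) n * l (vbasis {:V})`_i.
  by apply/funext => n /=; rewrite (scalar_vcoord l _ ll).
apply: cvg_big => [|i _]; first exact: add_continuous.
by apply: cvgM; [exact: cu|exact: cvg_cst].
Qed.

Definition is_vderive f (t : R) (v : V) : Prop :=
  forall i, is_derive t 1 (vcoord i \o f) (vcoord i v).

Lemma is_vderiveP f t v :
  is_vderive f t v <-> vderivable f t /\ vderive f t = v.
Proof.
split=> [df|[df <-] i].
  split=> [i|]; first by case: (df i).
  by apply: vcoordP => i; rewrite vcoord_sum derive1E; case: (df i).
by apply: DeriveDef; [exact: df|rewrite vcoord_sum derive1E].
Qed.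

Lemma is_vderive_scalar {f t v l} : scalar l -> is_vderive f t v ->
  is_derive t 1 (l \o f) (l v).
Proof.
move=> ll df; rewrite (scalar_vcoord l _ ll).
have -> : l \o f =
    \sum_(i < \dim {:V}) (l (vbasis {:V})`_i \*: (vcoord i \o f)).
  apply/funext => s; rewrite fct_sumE /= (scalar_vcoord l _ ll).
  by apply: eq_bigr => i _; rewrite mulrC.
apply: is_derive_sum => i; rewrite mulrC.
exact: (@is_deriveZ _ _ _ _ _ _ _ _ (df i)).
Qed.

Lemma is_vderive_comp f (s : R -> R) t v ds :
  is_vderive f (s t) v -> is_derive t 1 s ds ->
  is_vderive (f \o s) t (ds *: v).
Proof.
move=> df dss i; apply: is_derive_eq.
  exact: (@is_derive1_comp _ _ _ _ _ _ (df i) dss).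
by rewrite /vcoord linearZ /= mulrC.
Qed.

(** The tool behind the exponential identities below: an expression in [s] with zero derivative is
    evaluated by setting [s = 0]. *)
Lemma is_vderive0_cst f : (forall t, is_vderive f t 0) -> forall s t, f s = f t.
Proof.
move=> df s t; apply: vcoordP => i.
apply: (@is_derive_0_is_cst _ (vcoord i \o f)) => x.
by have := df x i; rewrite {2}/vcoord linear0.
Qed.

End Coordinates.

(** Expanding the first argument in a basis leaves a finite sum of products of real functions, to
    which the scalar product rule applies. *)
Lemma is_vderive_bilinear {R : realType} {V W : vectType R} {f : R -> V}
    {g : R -> W} {t : R} {v : V} {w : W} (B : V -> W -> R) :
  bilinear_for *%R *%R B -> is_vderive f t v -> is_vderive g t w ->
  is_derive t 1 (fun s => B (f s) (g s)) (B v (g t) + B (f t) w).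
Proof.
move=> [Bl Br] df dg.
pose e := vbasis {:V}.
have BE x y : B x y = \sum_(i < \dim {:V}) vcoord i x * B e`_i y.
  exact: (scalar_vcoord (B^~ y) _ (Bl y)).
have -> : (fun s => B (f s) (g s)) =
    \sum_(i < \dim {:V}) ((vcoord i \o f) * (B e`_i \o g)).
  by apply/funext => s; rewrite fct_sumE BE.
rewrite !BE -big_split /=.
apply: is_derive_sum => i.
apply: is_derive_eq.
  exact: (is_deriveM (df i) (is_vderive_scalar (Br _) dg)).
by rewrite /GRing.scale /= addrC mulrC [in X in _ + X]mulrC.
Qed.

(** * The operator exponential as a power series *)

Section Exponential.
Context {R : realType} {V : vectType R}.
Implicit Types (A D : 'End(V)) (l : 'End(V) -> R).

Definition lfun_pow (k : nat) A : 'End(V) := iter k (comp_lfun A) \1%VF.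

Lemma lfun_powS k A : lfun_pow k.+1 A = (A \o lfun_pow k A)%VF.
Proof. by []. Qed.

Lemma lfun_powSr k A : lfun_pow k.+1 A = (lfun_pow k A \o A)%VF.
Proof.
elim: k => [|k IH]; first by rewrite lfun_powS /= comp_lfun1l comp_lfun1r.
by rewrite [LHS]lfun_powS [in LHS]IH comp_lfunA.
Qed.

Lemma lfun_powZ k (s : R) A : lfun_pow k (s *: A) = s ^+ k *: lfun_pow k A.
Proof.
elim: k => [|k IH]; first by rewrite scale1r.
by rewrite !lfun_powS IH -comp_lfunZl -comp_lfunZr scalerA exprS.
Qed.

Lemma scalar_comp_lfunl {W : vectType R} (l : 'End(W) -> R) (A : 'End(W)) :
  scalar l -> scalar (fun B => l (A \o B)%VF).
Proof. by move=> ll a x y; rewrite comp_lfunDr -comp_lfunZr ll. Qed.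

Lemma scalar_comp_lfunr {W : vectType R} (l : 'End(W) -> R) (A : 'End(W)) :
  scalar l -> scalar (fun B => l (B \o A)%VF).
Proof. by move=> ll a x y; rewrite comp_lfunDl -comp_lfunZl ll. Qed.

(* With [N] the l1-norm of the coordinates, [N (A B) <= M N(B)], and every
   functional is bounded by a multiple of [N]. *)
Lemma lfun_pow_bound l A : scalar l ->
  exists C M : R, [/\ 0 <= C, 0 <= M & forall k, `|l (lfun_pow k A)| <= C * M ^+ k].
Proof.
move=> ll.
pose N (B : 'End(V)) : R := \sum_i `|vcoord i B|.
have N_ge0 B : 0 <= N B by apply: sumr_ge0.
pose S (m : 'End(V) -> R) : R :=
  \sum_(i < \dim {: 'End(V)}) `|m (vbasis {: 'End(V)})`_i|.
have S_ge0 m : 0 <= S m by apply: sumr_ge0.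
have le_S (m : 'End(V) -> R) B : scalar m -> `|m B| <= S m * N B.
  move=> lm; rewrite (scalar_vcoord m _ lm) (le_trans (ler_norm_sum _ _ _))//.
  rewrite mulr_sumr ler_sum// => i _; rewrite normrM mulrC ler_wpM2r//.
  by rewrite /S (bigD1 i)//= lerDl sumr_ge0.
pose M : R := \sum_i S (fun B => vcoord i (A \o B)%VF).
have M_ge0 : 0 <= M by apply: sumr_ge0.
have NA B : N (A \o B)%VF <= M * N B.
  rewrite mulr_suml; apply: ler_sum => i _.
  have lA := scalar_comp_lfunl _ A (vcoord_scalar i).
  exact: (le_S (fun B => vcoord i (A \o B)%VF) B lA).
exists (S l * N \1%VF), M; split=> [||k]; rewrite ?mulr_ge0//.
apply: (le_trans (le_S _ _ ll)); rewrite -mulrA ler_wpM2l//.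
elim: k => [|k IH]; first by rewrite expr0 mulr1.
rewrite (le_trans (NA _))// exprS mulrCA ler_wpM2l//.
Qed.

(* Applying [l] to the exponential of [s A] gives a scalar power series in [s],
   to which the library's termwise differentiation applies. *)
Definition exp_coef l A (k : nat) : R := k`!%:R^-1 * l (lfun_pow k A).

(** The factor [k + 1] of termwise differentiation cancels against [(k + 1)!], and the extra power
    of [A] is absorbed into the functional. The family [exp_coef] is thus stable under
    differentiation. *)
Lemma exp_coef_diffs l A : scalar l ->
  pseries_diffs (exp_coef l A) = exp_coef (fun B => l (A \o B)%VF) A.
Proof.
move=> ll; apply/funext => k; rewrite /pseries_diffs /exp_coef lfun_powS.
by rewrite factS natrM invfM mulrA mulVKf.
Qed.

(** By the geometric bound on the powers of [A], the series is dominated by [C] times the series of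
    [exp (M |x|)], so it converges everywhere. *)
Lemma is_cvg_exp_coef l A (x : R) : scalar l -> cvgn (pseries (exp_coef l A) x).
Proof.
move=> ll; have [C [M [C0 M0 CM]]] := lfun_pow_bound l A ll.
apply: normed_cvg.
apply: (@series_le_cvg _ _ (C *: exp_coeff (M * `|x|))) => [k|k|k|].
- exact: normr_ge0.
- by rewrite /= mulr_ge0// exp_coeff_ge0// mulr_ge0.
- rewrite exp_coeffE /= /exp_coef !normrM normrX ger0_norm ?invr_ge0//.
  rewrite -mulrA [leRHS](_ : _ = k`!%:R^-1 * (C * M ^+ k * `|x| ^+ k)).
    by rewrite ler_wpM2l ?invr_ge0// ler_wpM2r ?exprn_ge0.
  by rewrite -mulrA -exprMn mulrCA.
- by apply: is_cvg_seriesZ; exact: is_cvg_series_exp_coeff.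
Qed.

(** The bridge from [lfun_exp] to real power series: [s ^+ k] comes out of the [k]-th power of
    [s *: A], and the functional passes through the limit. *)
Lemma scalar_exp l A (s : R) : scalar l ->
  l (lfun_exp (s *: A)) = limn (pseries (exp_coef l A) s).
Proof.
move=> ll.
have E (m : 'End(V) -> R) : scalar m ->
    m \o (fun N : nat => \sum_(k < N) (k`!%:R)^-1 *: lfun_pow k (s *: A)) =
    pseries (exp_coef m A) s.
  move=> lm; apply/funext => N.
  rewrite /= scalar_comb// /pseries /series /= big_mkord.
  apply: eq_bigr => k _; rewrite lfun_powZ /exp_coef -mulrA; congr (_ * _).
  by have := lm (s ^+ k) (lfun_pow k A) 0; rewrite scalar0// !addr0 mulrC.
rewrite /lfun_exp scalar_vlim// => [|i]; first by rewrite -E.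
have := is_cvg_exp_coef _ A s (vcoord_scalar i).
by rewrite -E//; exact: vcoord_scalar.
Qed.

Lemma is_vderive_exp A (s : R) :
  is_vderive (fun u => lfun_exp (u *: A)) s (A \o lfun_exp (s *: A))%VF.
Proof.
move=> i; have li := vcoord_scalar (V := 'End(V)) i.
have lA := scalar_comp_lfunl _ A li; have lAA := scalar_comp_lfunl _ A lA.
rewrite (scalar_exp _ _ _ lA) -exp_coef_diffs//.
have -> : vcoord i \o (fun u => lfun_exp (u *: A)) =
          fun u => limn (pseries (exp_coef (vcoord i) A) u).
  by apply/funext => u; rewrite /= scalar_exp.
(* Differentiating at [s] requires the series and its first two formal derivatives to converge at
   some point of modulus above [|s|]; [|s| + 1] is such a point. *)
apply: (@pseries_snd_diffs _ _ (`|s| + 1)); rewrite ?exp_coef_diffs//.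
- exact: is_cvg_exp_coef.
- exact: is_cvg_exp_coef.
- exact: is_cvg_exp_coef.
- by rewrite [ltRHS]ger0_norm ?addr_ge0// ltrDl.
Qed.

(** Since [A] commutes with its own powers, both sides have the same power series in every
    coordinate. *)
Lemma lfun_exp_comm A (s : R) :
  (A \o lfun_exp (s *: A) = lfun_exp (s *: A) \o A)%VF.
Proof.
apply: vcoordP => i; have li := vcoord_scalar (V := 'End(V)) i.
rewrite (scalar_exp _ _ _ (scalar_comp_lfunl _ A li)).
rewrite (scalar_exp _ _ _ (scalar_comp_lfunr _ A li)).
congr (limn (pseries _ s)); apply/funext => k; rewrite /exp_coef.
by rewrite -lfun_powS lfun_powSr.
Qed.

Lemma lfun_exp0 A : lfun_exp (0 *: A) = \1%VF.
Proof.
apply: vcoordP => i; rewrite (scalar_exp _ _ _ (vcoord_scalar i)).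
(* The partial sum over no terms is 0, so it is shifted away; at [s = 0] all the others reduce to
   the constant term. *)
apply/cvg_lim => //; rewrite -(cvg_shiftS _) /=.
have -> : (fun n => pseries (exp_coef (vcoord i) A) 0 n.+1) = fun=> vcoord i \1%VF.
  apply/funext => n; rewrite /pseries /series /= big_mkord big_ord_recl /=.
  rewrite big1 => [|j _].
    by rewrite /exp_coef expr0 mulr1 fact0 invr1 mul1r addr0.
  by rewrite expr0n mulr0.
exact: cvg_cst.
Qed.

End Exponential.

Lemma scalar_linearP {R : nzRingType} {V W : lmodType R} (l : W -> R) (f : V -> W) :
  scalar l -> linear f -> scalar (fun x => l (f x)).
Proof. by move=> ll lf a x y; rewrite lf ll. Qed.

Lemma linear_apply_lfun {R : realType} {V : vectType R} (x : V) :
  linear (fun A : 'End(V) => A x).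
Proof. by move=> a A B; rewrite add_lfunE scale_lfunE. Qed.

Lemma is_vderive_apply {R : realType} {V : vectType R} {f : R -> 'End(V)} {t A}
  (x : V) : is_vderive f t A -> is_vderive (fun s => f s x) t (A x).
Proof.
move=> df i.
have lx := scalar_linearP _ _ (vcoord_scalar i) (linear_apply_lfun x).
exact: (is_vderive_scalar lx df).
Qed.

Lemma is_vderive_expE {R : realType} {V : vectType R} (A : 'End(V)) (s : R) x :
  is_vderive (fun u => lfun_exp (u *: A) x) s (A (lfun_exp (s *: A) x)).
Proof. by have := is_vderive_apply x (is_vderive_exp A s); rewrite comp_lfunE. Qed.

Lemma is_vderive_expNE {R : realType} {V : vectType R} (A : 'End(V)) (s : R) :
  is_vderive (fun u => lfun_exp (- u *: A)) s
    (- (A \o lfun_exp (- s *: A))%VF).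
Proof.
rewrite -scaleN1r.
apply: (is_vderive_comp (fun u => lfun_exp (u *: A)) (fun u => - u)).
  exact: is_vderive_exp.
Qed.

(** * Inverses of exponentials *)

Section ExponentialGroup.
Context {R : realType} {V : vectType R}.
Implicit Types (A : 'End(V)).

Lemma lfun_exp_commE A (s : R) x : 
  A (lfun_exp (s *: A) x) = lfun_exp (s *: A) (A x).
Proof. by rewrite -!comp_lfunE lfun_exp_comm. Qed.

Lemma bilinear_apply_lfun (l : V -> R) : scalar l ->
  bilinear_for *%R *%R (fun (B : 'End(V)) (x : V) => l (B x)).
Proof.
move=> ll; split=> [x|B] a y z /=; last by rewrite linearP ll.
by rewrite linear_apply_lfun ll.
Qed.

(** The product [exp(-uA) exp(uA) x] has zero derivative in [u]: the two terms of the product rule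
    cancel because [A] commutes with [exp(-uA)]. *)
Lemma lfun_expNK A (s : R) : cancel (lfun_exp (s *: A)) (lfun_exp (- s *: A)).
Proof.
move=> x; pose f u := lfun_exp (- u *: A) (lfun_exp (u *: A) x).
have {2}-> : x = f 0 by rewrite /f oppr0 lfun_exp0 !id_lfunE.
rewrite -[LHS]/(f s); apply: (is_vderive0_cst f) => t i.
apply: is_derive_eq.
  exact: (is_vderive_bilinear _ (bilinear_apply_lfun _ (vcoord_scalar i))
    (is_vderive_expNE A t) (is_vderive_expE A t x)).
by rewrite /= opp_lfunE comp_lfunE (lfun_exp_commE A (- t)) /vcoord -linearD addNr.
Qed.

Lemma lfun_exp_bij A (s : R) : bijective (lfun_exp (s *: A)).
Proof.
exists (lfun_exp (- s *: A)); first exact: lfun_expNK.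
by have := lfun_expNK A (- s); rewrite opprK.
Qed.

End ExponentialGroup.

(** * Derivations and automorphisms of the Lie algebra *)

Section Derivations.
Context {R : realType} {L : lieAlgType R}.
Implicit Types (D : 'End(L)).

Lemma bilinear_lie (l : L -> R) : scalar l ->
  bilinear_for *%R *%R (fun x y : L => l (lie x y)).
Proof.
have [lL lR] := @lie_bilinear R L.
by move=> ll; split=> z a x y /=; rewrite ?lL ?lR ll.
Qed.

Lemma is_vderive_lie {f g : R -> L} {t v w} :
  is_vderive f t v -> is_vderive g t w ->
  is_vderive (fun s => lie (f s) (g s)) t (lie v (g t) + lie (f t) w).
Proof.
move=> df dg i; rewrite {2}/vcoord linearD.
exact: (is_vderive_bilinear _ (bilinear_lie _ (vcoord_scalar i)) df dg).
Qed.

Lemma lie_aut_exp D (s : R) : derivation D -> lie_aut (lfun_exp (s *: D)).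
Proof.
move=> derD; split=> [|x y]; first exact: lfun_exp_bij.
pose E u := lfun_exp (u *: D).
pose f u := E (- u) (lie (E u x) (E u y)).
(* Applying the injective [E (- s)] to both sides reduces the claim to [lie x y = f s]. *)
apply: (@can_inj _ _ (E (- s)) (E s)).
  by have := lfun_expNK D (- s); rewrite opprK.
rewrite [LHS]lfun_expNK.
(* [f] has zero derivative because [D] is a derivation commuting with [E]. *)
have -> : lie x y = f 0 by rewrite /f /E oppr0 lfun_exp0 !id_lfunE.
rewrite -[RHS]/(f s); apply: (is_vderive0_cst f) => t i.
apply: is_derive_eq.
  exact: (is_vderive_bilinear _ (bilinear_apply_lfun _ (vcoord_scalar i))
    (is_vderive_expNE D t)
    (is_vderive_lie (is_vderive_expE D t x) (is_vderive_expE D t y))).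
rewrite /= opp_lfunE comp_lfunE (lfun_exp_commE D (- t)) derD.
by rewrite /vcoord -linearD addNr.
Qed.

(** Both sides of [phi t [x, y] = [phi t x, phi t y]] are differentiated at 0, where [phi] is the
    identity. *)
Lemma derivation_vderive (phi : R -> 'End(L)) D :
  (\forall t \near 0, lie_aut (phi t)) -> phi 0 = \1%VF ->
  is_vderive phi 0 D -> derivation D.
Proof.
move=> aut phi0 dphi x y; apply: vcoordP => i.
have d1 := is_vderive_apply (lie x y) dphi i.
have d2 := is_vderive_lie (is_vderive_apply x dphi) (is_vderive_apply y dphi) i.
rewrite !phi0 !id_lfunE in d2.
rewrite -(@derive_val _ _ _ _ _ _ _ d1) -(@derive_val _ _ _ _ _ _ _ d2).
apply: near_eq_derive; apply: filterS aut => t [_ lie_phi].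
by rewrite /= lie_phi.
Qed.

End Derivations.

(** * Operators representing forms, and pullbacks of almost-hermitian structures *)

Section Forms.
Context {R : realType} {V : vectType R}.
Implicit Types (a b : V -> V -> R).

Definition nondegenerate b := forall x, (forall y, b x y = 0) -> x = 0.

(* [row c x] lists the values of [c x] on a basis; for a nondegenerate [b] the
   map [row b] is an isomorphism onto the row vectors. *)
Lemma form_opE a b : nondegenerate b ->
  bilinear_for *%R *%R b -> bilinear_for *%R *%R a ->
  forall x y, a x y = b (form_op b a x) y.
Proof.
move=> ndb [bl br] [al ar].
suff : exists A : 'End(V), forall x y, a x y = b (A x) y.
  by move=> exA; exact: (xgetPex (0 : 'End(V)) exA).
pose n := \dim {:V}; pose e := vbasis {:V}.
pose row (c : V -> V -> R) x : 'rV[R]_n := \row_j c x e`_j.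
have row_lin c : (forall y, scalar (c^~ y)) -> linear (row c).
  by move=> cl k x y; apply/rowP => j; rewrite !mxE cl.
pose F (c : V -> V -> R) (cl : forall y, scalar (c^~ y)) : 'Hom(V, 'rV[R]_n) :=
  linfun (HB.pack (row c) (GRing.isLinear.Build _ _ _ _ _ (row_lin c cl))
    : {linear V -> 'rV[R]_n}).
have FE c cl x : F c cl x = row c x by rewrite lfunE.
have eq_row (c c' : V -> V -> R) x x' : scalar (c x) -> scalar (c' x') ->
    row c x = row c' x' -> c x =1 c' x'.
  move=> cx cx' /rowP rx y.
  rewrite (scalar_vcoord (c x) _ cx) (scalar_vcoord (c' x') _ cx').
  by apply: eq_bigr => j _; have := rx j; rewrite !mxE => ->.
have kerF : lker (F b bl) == 0%VS.
  apply/lker0P => x x'; rewrite !FE => /(eq_row _ _ _ _ (br x) (br x')) bxx'.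
  apply/eqP; rewrite -subr_eq0; apply/eqP/ndb => y.
  by rewrite -scaleN1r addrC bl /= bxx' mulN1r addNr.
(* Source and target have the same dimension, so injectivity gives surjectivity. *)
have imF : limg (F b bl) = fullv.
  apply/eqP; rewrite eqEdim subvf /= dimvf /dim /= mul1n.
  by rewrite (limg_dim_eq (eqP _)) // (eqP kerF) capv0.
exists ((F b bl)^-1 \o F a al)%VF => x y.
apply: eq_row => //; rewrite -!FE comp_lfunE limg_lfunVK// imF memvf //.
Qed.

(** Nondegeneracy makes the choice in [form_op] immaterial: the values at [x] of two representing
    operators differ by a vector that [b] pairs to 0 with everything. *)
Lemma form_op_unique a b (A : 'End(V)) : nondegenerate b ->
  (forall y, scalar (b^~ y)) ->
  (forall x y, a x y = b (A x) y) -> form_op b a = A.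
Proof.
move=> ndb bl aA; apply/lfunP => x.
have aE : forall x y, a x y = b (form_op b a x) y.
  have exA : exists B : 'End(V), forall x y, a x y = b (B x) y by exists A.
  exact: (xgetPex (0 : 'End(V)) exA).
apply/eqP; rewrite -subr_eq0; apply/eqP/ndb => y.
by rewrite -scaleN1r addrC bl /= -aE aA mulN1r addNr.
Qed.

Lemma biscalarP (f : {biscalar V}) : bilinear_for *%R *%R f.
Proof. by split=> u a x y; rewrite ?linearPl ?linearPr. Qed.

Lemma metric_nondegenerate (h : almost_hermitian V) : nondegenerate (metric h).
Proof.
move=> x gx; apply/eqP; apply: contraT => /(metric_posdef h).
by rewrite gx ltxx.
Qed.

Lemma JopE (h : almost_hermitian V) x y : omega h x y = metric h (Jop h x) y.
Proof.
apply: form_opE; [exact: metric_nondegenerate|exact: biscalarP|exact: biscalarP].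
Qed.

Lemma JopK (h : almost_hermitian V) x : Jop h (Jop h x) = - x.
Proof.
have /lfunP/(_ x) := complex_structure_square h.
by rewrite comp_lfunE opp_lfunE id_lfunE.
Qed.

Lemma bilinear_pullback (f : {biscalar V}) (k : R) (A B : 'End(V)) :
  bilinear_for *%R *%R (fun x y => k * f (A x) (B y)).
Proof.
by split=> u a x y /=; rewrite linearP /= ?linearPl ?linearPr.
Qed.

Lemma transposeE (h : almost_hermitian V) (A : 'End(V)) x y :
  metric h x (A y) = metric h (transpose h A x) y.
Proof.
apply: (form_opE (fun x y => metric h x (A y))).
- exact: metric_nondegenerate.
- exact: biscalarP.
- by split=> u a v w; rewrite ?linearP ?linearPl ?linearPr.
Qed.

(** Named so that the instance below makes it a [{biscalar V}], the type of the fields of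
    [almost_hermitian]. *)
Definition pullback_form (f : {biscalar V}) (k : R) (A : 'End(V)) : V -> V -> R :=
  fun x y => k * f (A x) (A y).

HB.instance Definition _ f k A := bilinear_isBilinear.Build R V V R *%R *%R
  (pullback_form f k A) (bilinear_pullback f k A A).

Section Pullback.
Variables (h : almost_hermitian V) (k : R) (A : 'End(V)).
Hypotheses (k0 : 0 < k) (A_bij : bijective A).

Let A_ker : lker A == 0%VS. Proof. exact/lker0P/bij_inj. Qed.

Lemma pullback_nondegenerate (b : {biscalar V}) :
  nondegenerate b -> nondegenerate (pullback_form b k A).
Proof.
move=> ndb x bx; have [A' AK A'K] := A_bij.
apply: (can_inj AK); rewrite linear0; apply: ndb => y.
apply: (mulfI (lt0r_neq0 k0)); rewrite mulr0 -(bx (A' y)).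
by rewrite /pullback_form A'K.
Qed.

Lemma pullback_posdef x : x != 0 -> 0 < pullback_form (metric h) k A x x.
Proof.
move=> x0; rewrite mulr_gt0//; apply: metric_posdef.
by apply: contra_neq x0 => Ax0; apply: (bij_inj A_bij); rewrite linear0.
Qed.

Lemma pullback_alternating x : pullback_form (omega h) k A x x = 0.
Proof. by rewrite /pullback_form omega_alternating mulr0. Qed.

Lemma pullback_symmetric x y :
  pullback_form (metric h) k A x y = pullback_form (metric h) k A y x.
Proof. by rewrite /pullback_form metric_symmetric. Qed.

(** Both forms carry the same factor [k], so only conjugation by [A] remains; this is why the square
    stays [-1]. *)
Lemma pullback_Jop :
  form_op (pullback_form (metric h) k A) (pullback_form (omega h) k A) =
  (A^-1 \o Jop h \o A)%VF.
Proof.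
apply: form_op_unique => [||x y].
- exact/pullback_nondegenerate/metric_nondegenerate.
- exact: (biscalarP (pullback_form (metric h) k A)).1.
- by rewrite /pullback_form !comp_lfunE lker0_lfunVK// JopE.
Qed.

Lemma pullback_Jop_square :
  let J := form_op (pullback_form (metric h) k A) (pullback_form (omega h) k A) in
  (J \o J)%VF = - \1%VF.
Proof.
rewrite /= pullback_Jop; apply/lfunP => x.
rewrite opp_lfunE id_lfunE !comp_lfunE lker0_lfunVK// JopK linearN /=.
by rewrite lker0_lfunK.
Qed.

(** The structure [k A^* h], the shape of the solutions in (i) and (iii) at a fixed time. *)
Definition pullback : almost_hermitian V :=
  @AlmostHermitian R V
    (pullback_form (omega h) k A) (pullback_form (metric h) k A)
    pullback_alternating
    (pullback_nondegenerate (omega h) (@omega_nondegenerate _ _ h))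
    pullback_symmetric pullback_posdef pullback_Jop_square.

End Pullback.

End Forms.

(** * First-order deformation of a structure *)

Section StructureDerivative.
Context {R : realType} {V : vectType R}.
Implicit Types (h : almost_hermitian V) (D : 'End(V)).

Lemma is_derive_pullback (f : {biscalar V}) {c : R -> R} {phi : R -> 'End(V)}
    {t c' : R} {A} (x y : V) : is_derive t 1 c c' -> is_vderive phi t A ->
  is_derive t 1 (fun u => c u * f (phi u x) (phi u y))
    (c' * f (phi t x) (phi t y) + c t * (f (A x) (phi t y) + f (phi t x) (A y))).
Proof.
move=> dc dphi; apply: is_derive_eq.
  exact: (is_deriveM dc (is_vderive_bilinear _ (biscalarP f)
    (is_vderive_apply x dphi) (is_vderive_apply y dphi))).
by rewrite /GRing.scale /= addrC [in X in X + _]mulrC.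
Qed.

(** Moving [D] to the left slot: [omega(x, D y) = g(J x, D y) = g(D^t J x, y)], which is
    [- omega(J D^t J x, y)] because [J^2 = -1]. *)
Lemma omega_deformation h (a : R) D x y :
  a * omega h x y + (omega h (D x) y + omega h x (D y)) =
  omega h ((a *: \1%VF + (D - (Jop h \o transpose h D \o Jop h)%VF)) x) y.
Proof.
have -> : omega h x (D y) = - omega h (Jop h (transpose h D (Jop h x))) y.
  by rewrite JopE transposeE [in RHS]JopE JopK linearNl opprK.
rewrite !add_lfunE scale_lfunE id_lfunE opp_lfunE !comp_lfunE.
by rewrite linearPl /= linearDl linearNl.
Qed.

Lemma metric_deformation h (a : R) D x y :
  a * metric h x y + (metric h (D x) y + metric h x (D y)) =
  metric h ((a *: \1%VF + (D + transpose h D)) x) y.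
Proof.
rewrite transposeE !add_lfunE scale_lfunE id_lfunE.
by rewrite linearPl /= linearDl.
Qed.

Lemma nondegenerate_lfunP (b : {biscalar V}) (A B : 'End(V)) : nondegenerate b ->
  (A = B <-> forall x y, b (A x) y = b (B x) y).
Proof.
move=> ndb; split=> [->//|AB]; apply/lfunP => x; apply/eqP; rewrite -subr_eq0.
by apply/eqP/ndb => y; rewrite linearBl AB subrr.
Qed.

End StructureDerivative.

(** * The curvature operators and condition (ii) *)

Section CurvatureOperators.
Context {R : realType} {K : curvature_rule R} {L : lieAlgType R}.
Implicit Types (h : almost_hermitian L) (A D : 'End(L)).

Lemma PopE h x y : pform K h x y = omega h (Pop K h x) y.
Proof.
apply: form_opE; [exact: omega_nondegenerate|exact: biscalarP|exact: biscalarP].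
Qed.

Lemma QopE h x y : qform K h x y = metric h (Qop K h x) y.
Proof.
apply: form_opE; [exact: metric_nondegenerate|exact: biscalarP|exact: biscalarP].
Qed.

(** Scale invariance removes [k], leaving [h1 = A^* h]. Invariance under [A] then gives
    [P(h) A = A P(h1)], so [omega(P(h) A x, A y) = omega(A P(h1) x, A y)], which is the form
    [p(h1)]; the same holds for [q]. *)
Lemma curvature_pullback h (k : R) A (k0 : 0 < k) (A_bij : bijective A) :
  diffeo_invariant K -> scale_invariant K -> lie_aut A -> forall x y,
  pform K (pullback h k A k0 A_bij) x y = pform K h (A x) (A y) /\
  qform K (pullback h k A k0 A_bij) x y = qform K h (A x) (A y).
Proof.
move=> Kinv Kscale autA x y.
pose h1 := pullback h 1 A ltr01 A_bij.
have kerA : lker A == 0%VS by apply/lker0P/bij_inj.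
have [||-> ->] := Kscale _ h1 (pullback h k A k0 A_bij) k k0 _ _ x y.
- by move=> u v; rewrite /= /pullback_form mul1r.
- by move=> u v; rewrite /= /pullback_form mul1r.
have [||Ph Qh] := Kinv _ _ h1 h A autA.
- by move=> u v; rewrite /= /pullback_form mul1r.
- by move=> u v; rewrite /= /pullback_form mul1r.
rewrite !PopE !QopE Ph Qh !comp_lfunE !lker0_lfunK//=.
by rewrite /pullback_form !mul1r.
Qed.

(** By nondegeneracy, (ii) becomes an identity of bilinear forms, which can be compared with
    derivatives and evaluated at transported vectors. *)
Lemma curvature_equationsP h (a : R) D :
  (a *: \1%VF + (D - (Jop h \o transpose h D \o Jop h)%VF) = - 2 *: Pop K h /\
   a *: \1%VF + (D + transpose h D) = - 2 *: Qop K h) <->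
  (forall x y,
    a * omega h x y + (omega h (D x) y + omega h x (D y)) = - 2 * pform K h x y /\
    a * metric h x y + (metric h (D x) y + metric h x (D y)) = - 2 * qform K h x y).
Proof.
rewrite (nondegenerate_lfunP _ _ _ (@omega_nondegenerate _ _ h)).
rewrite (nondegenerate_lfunP _ _ _ (metric_nondegenerate h)).
split=> [[eP eQ] x y|ePQ].
  by rewrite omega_deformation metric_deformation eP eQ !scale_lfunE
    !linearZl_LR PopE QopE.
split=> x y; have [eP eQ] := ePQ x y.
  by rewrite -omega_deformation eP scale_lfunE linearZl_LR PopE.
by rewrite -metric_deformation eQ scale_lfunE linearZl_LR QopE.
Qed.

End CurvatureOperators.

(** * The time change [s(t)] *)

Section TimeChange.
Context {R : realType}.
Implicit Types (a t : R).

Lemma time_change0 a : time_change a 0 = 0.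
Proof. by rewrite /time_change mulr0 add0r ln1 mul0r if_same. Qed.

Lemma is_derive_affine a t : is_derive t 1 (fun u => a * u + 1) a.
Proof.
apply: is_derive_eq.
by rewrite /GRing.scale /= mulr1 addr0.
Qed.

(** For [a = 0] the definition switches to the identity, whose derivative 1 agrees with the formula;
    otherwise the chain-rule factor [a] cancels the division by [a]. *)
Lemma is_derive_time_change a t : 0 < a * t + 1 ->
  is_derive t 1 (time_change a) (a * t + 1)^-1.
Proof.
move=> at0; have [->|a0] := eqVneq a 0.
  rewrite mul0r add0r invr1.
  have -> : time_change 0 = id :> (R -> R).
    by apply/funext => u; rewrite /time_change eqxx.
  exact: is_derive_id.
have -> : time_change a = a^-1 \*: (@ln R \o (fun u => a * u + 1)).
  by apply/funext => u; rewrite /time_change (negbTE a0) /= /GRing.scale /= mulrC.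
have dln := is_derive1_ln at0.
have dcomp := @is_derive1_comp _ (@ln R) (fun u => a * u + 1) t _ _ dln
  (is_derive_affine a t).
apply: (is_derive_eq (@is_deriveZ _ _ _ _ a^-1 _ _ _ dcomp)).
by rewrite /GRing.scale /= mulrCA mulVf// mulr1.
Qed.

End TimeChange.

(** * Self-similar solutions of the flow *)

Section SelfSimilar.
Context {R : realType}.
Implicit Types (K : curvature_rule R) (L : lieAlgType R) (I : set R).

Lemma is_vderive_exp_time_change {V : vectType R} (a : R) (D : 'End(V)) (t : R) :
  0 < a * t + 1 ->
  is_vderive (fun u => lfun_exp (time_change a u *: D)) t
    ((a * t + 1)^-1 *: (D \o lfun_exp (time_change a t *: D))%VF).
Proof.
move=> /is_derive_time_change.
exact: (is_vderive_comp (fun u => lfun_exp (u *: D))) (is_vderive_exp _ _).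
Qed.

(* The time change makes [(a t + 1) s'(t) = 1], so the factor in front of the
   deformation term cancels. *)
Lemma is_derive_self_similar {V : vectType R} (f : {biscalar V}) (a : R)
    (D : 'End(V)) (t : R) (x y : V) : 0 < a * t + 1 ->
  let E u := lfun_exp (time_change a u *: D) in
  is_derive t 1 (fun u => (a * u + 1) * f (E u x) (E u y))
    (a * f (E t x) (E t y)
     + (f (D (E t x)) (E t y) + f (E t x) (D (E t y)))).
Proof.
move=> at0 E; have dE := is_vderive_exp_time_change a D t at0.
apply: is_derive_eq; first exact: is_derive_pullback (is_derive_affine a t) dE.
rewrite !scale_lfunE !comp_lfunE linearZl_LR linearZr_LR /= -mulrDr mulrA.
by rewrite mulfV ?mul1r// lt0r_neq0.
Qed.

Lemma self_similar_solution K L I (h0 : almost_hermitian L) (a : R) (D : 'End(L)) :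
  diffeo_invariant K -> scale_invariant K -> I 0 ->
  (forall t, I t -> 0 < a * t + 1) -> derivation D ->
  a *: \1%VF + (D - (Jop h0 \o transpose h0 D \o Jop h0)%VF) = - 2 *: Pop K h0 ->
  a *: \1%VF + (D + transpose h0 D) = - 2 *: Qop K h0 ->
  open I ->
  exists h : R -> almost_hermitian L,
    [/\ flow_solution K I h, same_structure (h 0) h0
      & evolves_as I h h0 (fun t => a * t + 1)
          (fun t => lfun_exp (time_change a t *: D))].
Proof.
move=> Kinv Kscale I0 Ipos derD eP eQ oI.
pose E t := lfun_exp (time_change a t *: D).
have E_bij t : bijective (E t) by exact: lfun_exp_bij.
(* A structure exists only for a positive factor [a t + 1]; elsewhere [h0] is a default value, never
   reached on [I]. *)
pose h t := if pselect (0 < a * t + 1) is left at0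
  then pullback h0 (a * t + 1) (E t) at0 (E_bij t) else h0.
have hE t : 0 < a * t + 1 ->
    exists at0, h t = pullback h0 (a * t + 1) (E t) at0 (E_bij t).
  by rewrite /h; case: pselect => // at0 _; exists at0.
have ev : evolves_as I h h0 (fun t => a * t + 1) E.
  by move=> t /Ipos /hE[at0 ->].
exists h; split=> //; last first.
  move=> x y; have [-> ->] := ev 0 I0 x y.
  by rewrite mulr0 add0r !mul1r /E time_change0 lfun_exp0 !id_lfunE.
move=> t It x y; have at0 := Ipos t It.
have [at0' ->] := hE t at0.
have [-> ->] := curvature_pullback h0 _ _ at0' (E_bij t) Kinv Kscale
  (lie_aut_exp D _ derD) x y.
(* Equations (ii), read at the transported vectors, turn the curvature terms into the derivatives
   given by [is_derive_self_similar]. *)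
have [<- <-] :=
  (curvature_equationsP h0 a D).1 (conj eP eQ) (E t x) (E t y).
(* The explicit formula for [h] is known on [I] only; openness makes it hold near [t], which
   suffices for the derivative. *)
have In : \forall u \near t, I u by exact: open_nbhs_nbhs.
split.
- apply: near_eq_is_derive (is_derive_self_similar (omega h0) a D t x y at0).
  by apply: filterS In => u Iu; have [-> _] := ev u Iu x y.
- apply: near_eq_is_derive (is_derive_self_similar (metric h0) a D t x y at0).
  by apply: filterS In => u Iu; have [_ ->] := ev u Iu x y.
Qed.

(** At time 0 the derivative of the solution is computed twice, from the flow and from the ansatz,
    and the two values are equated. *)
Lemma curvature_equations_of_evolution K L I (h : R -> almost_hermitian L)
    (h0 : almost_hermitian L) (c : R -> R) (phi : R -> 'End(L)) :
  open I -> I 0 -> flow_solution K I h -> h 0 = h0 ->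
  scaling_gauge I c phi -> evolves_as I h h0 c phi ->
  derive1 c 0 *: \1%VF
    + (vderive phi 0 - (Jop h0 \o transpose h0 (vderive phi 0) \o Jop h0)%VF)
    = - 2 *: Pop K h0 /\
  derive1 c 0 *: \1%VF + (vderive phi 0 + transpose h0 (vderive phi 0))
    = - 2 *: Qop K h0.
Proof.
move=> oI I0 hsol hstart [cI phiI c0 phi0] ev; apply/curvature_equationsP => x y.
have dc : is_derive (0 : R) 1 c (derive1 c 0).
  by apply: DeriveDef; [exact: (cI 0 I0).2|rewrite derive1E].
have dphi : is_vderive phi 0 (vderive phi 0).
  by apply/is_vderiveP; split=> //; exact: (phiI 0 I0).2.
have In : \forall u \near (0 : R), I u by exact: open_nbhs_nbhs.
have [dw dg] := hsol 0 I0 x y; rewrite hstart in dw dg.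
have dw' := is_derive_pullback (omega h0) x y dc dphi.
have dg' := is_derive_pullback (metric h0) x y dc dphi.
rewrite !phi0 !id_lfunE c0 !mul1r in dw' dg'.
split.
- rewrite -(@derive_val _ _ _ _ _ _ _ dw) -(@derive_val _ _ _ _ _ _ _ dw').
  by apply: near_eq_derive; apply: filterS In => u Iu; have [-> _] := ev u Iu x y.
- rewrite -(@derive_val _ _ _ _ _ _ _ dg) -(@derive_val _ _ _ _ _ _ _ dg').
  by apply: near_eq_derive; apply: filterS In => u Iu; have [_ ->] := ev u Iu x y.
Qed.

(** Supplies the witness for (iii) implies (i): [s(0) = 0] and [s'(0) = 1] give the exponential
    curve the prescribed initial value and velocity. *)
Lemma scaling_gauge_exp L I (a : R) (D : 'End(L)) :
  derivation D -> I 0 -> (forall t, I t -> 0 < a * t + 1) ->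
  let c t := a * t + 1 in let phi t := lfun_exp (time_change a t *: D) in
  [/\ scaling_gauge I c phi, derive1 c 0 = a & vderive phi 0 = D].
Proof.
move=> derD I0 Ipos c phi.
have dphi t (It : I t) :=
  (is_vderiveP _ _ _).1 (is_vderive_exp_time_change a D t (Ipos t It)).
have dc (t : R) : is_derive t 1 c a := is_derive_affine a t.
split.
- split=> [t It|t It||].
  + by split; [exact: Ipos|case: (dc t)].
  + by split; [exact: lie_aut_exp|exact: (dphi t It).1].
  + by rewrite /c mulr0 add0r.
  + by rewrite /phi time_change0 lfun_exp0.
- by rewrite derive1E; case: (dc 0).
- rewrite (dphi 0 I0).2 mulr0 add0r invr1 scale1r time_change0 lfun_exp0.
  exact: comp_lfun1r.
Qed.

End SelfSimilar.

Theorem lemma7p1 (R : realType) (K : curvature_rule R)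
  (Kinv : diffeo_invariant K) (Kcompat : compatible K)
  (Kscale : scale_invariant K) (Kexist : short_time_existence K)
  (Kunique : flow_uniqueness K)
  (n : nat) (L : lieAlgType R) (dimL : \dim {:L} = n.*2)
  (h0 : almost_hermitian L)
  (I : set R) (h : R -> almost_hermitian L)
  (I0 : open_interval0 I) (hsol : flow_solution K I h) (hstart : h 0 = h0)
  (c : R -> R) (phi : R -> 'End(L)) (cphi : scaling_gauge I c phi)
  (D : 'End(L)) (Dphi : D = vderive phi 0)
  (Ipos : forall t, I t -> 0 < derive1 c 0 * t + 1) :
  derivation D /\
  [<-> exists (c1 : R -> R) (phi1 : R -> 'End(L)),
         [/\ scaling_gauge I c1 phi1, derive1 c1 0 = derive1 c 0, vderive phi1 0 = D
           & evolves_as I h h0 c1 phi1];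
       derive1 c 0 *: \1%VF + (D - (Jop h0 \o transpose h0 D \o Jop h0)%VF)
           = - 2 *: Pop K h0 /\
         derive1 c 0 *: \1%VF + (D + transpose h0 D) = - 2 *: Qop K h0;
       evolves_as I h h0 (fun t => derive1 c 0 * t + 1)
         (fun t => lfun_exp (time_change (derive1 c 0) t *: D))].
Proof.
have [oI _ z0] := I0.
have derD : derivation D.
  have [_ phiI _ phi0] := cphi.
  apply: (derivation_vderive phi) => //.
    by apply: filterS (open_nbhs_nbhs (conj oI z0)) => t /phiI[].
  by apply/is_vderiveP; split=> //; exact: (phiI 0 z0).2.
split=> //; tfae.
- move=> [c1 [phi1 [gauge1 <- <- ev1]]].
  exact: curvature_equations_of_evolution gauge1 ev1.
(* Uniqueness identifies [h] on [I] with the explicit solution built from (ii), as both start at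
   [h0]. *)
- move=> [eP eQ].
  have [h' [sol' h'0 ev']] :=
    self_similar_solution K L I h0 _ D Kinv Kscale z0 Ipos derD eP eQ oI.
  have same := Kunique L I h h' I0 hsol sol'.
  move=> t It x y; have [|-> ->] := same _ t It x y; last exact: ev'.
  by move=> u v; have [-> ->] := h'0 u v; rewrite hstart.
- move=> ev; have [gauge cE phiE] := scaling_gauge_exp L I _ D derD z0 Ipos.
  by exists (fun t => derive1 c 0 * t + 1),
    (fun t => lfun_exp (time_change (derive1 c 0) t *: D)).
Qed.
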